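(* Let $\mathcal{X}$ be a finite nonempty set. For every natural topology $\mathcal{T}$ on $\mathrm{DMC}_{\mathcal{X},\ast}^{(o)}$, the space $(\mathrm{DMC}_{\mathcal{X},\ast}^{(o)},\mathcal{T})$ is $\sigma$-compact, separable and path-connected.
   Context: For finite nonempty sets $\mathcal{X},\mathcal{Y}$, $\mathrm{DMC}_{\mathcal{X},\mathcal{Y}}$ is the set of channels from $\mathcal{X}$ to $\mathcal{Y}$, i.e. functions $W:\mathcal{X}\times\mathcal{Y}\to[0,1]$, written $W(y|x)$, with $\sum_{y\in\mathcal{Y}}W(y|x)=1$ for every $x\in\mathcal{X}$. It carries the topology inherited from the Euclidean topology of $\mathbb{R}^{\mathcal{X}\times\mathcal{Y}}$. For $W\in\mathrm{DMC}_{\mathcal{X},\mathcal{Y}}$ and $V\in\mathrm{DMC}_{\mathcal{Y},\mathcal{Z}}$, the composition $V\circ W\in\mathrm{DMC}_{\mathcal{X},\mathcal{Z}}$ is $(V\circ W)(z|x)=\sum_{y\in\mathcal{Y}}V(z|y)W(y|x)$. A channel $W'\in\mathrm{DMC}_{\mathcal{X},\mathcal{Z}}$ is degraded from $W\in\mathrm{DMC}_{\mathcal{X},\mathcal{Y}}$ if $W'=V\circ W$ for some $V\in\mathrm{DMC}_{\mathcal{Y},\mathcal{Z}}$; $W$ and $W'$ are equivalent if each is degraded from the other. $\mathrm{DMC}_{\mathcal{X},\mathcal{Y}}^{(o)}$ is the quotient of $\mathrm{DMC}_{\mathcal{X},\mathcal{Y}}$ by this equivalence relation, with the quotient topology $\mathcal{T}_{\mathcal{X},\mathcal{Y}}^{(o)}$.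 Let $[n]=\{1,\dots,n\}$, let $\mathrm{DMC}_{\mathcal{X},\ast}=\coprod_{n\ge1}\mathrm{DMC}_{\mathcal{X},[n]}$, and let $\mathrm{DMC}_{\mathcal{X},\ast}^{(o)}$ be the quotient set of $\mathrm{DMC}_{\mathcal{X},\ast}$ by equivalence of channels. For each $n\geq 1$, $\mathrm{DMC}_{\mathcal{X},[n]}^{(o)}$ is identified with the subset of $\mathrm{DMC}_{\mathcal{X},\ast}^{(o)}$ consisting of the classes containing a channel with output alphabet $[n]$; these subsets increase with $n$ and their union is $\mathrm{DMC}_{\mathcal{X},\ast}^{(o)}$. A topology on $\mathrm{DMC}_{\mathcal{X},\ast}^{(o)}$ is called natural if for every $n\ge1$ the subspace topology it induces on $\mathrm{DMC}_{\mathcal{X},[n]}^{(o)}$ is $\mathcal{T}_{\mathcal{X},[n]}^{(o)}$. $\sigma$-compact means being a countable union of compact subspaces (no Hausdorff assumption). *)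

(* Defs.v *)
From HB Require Import structures.
From mathcomp Require Import all_boot all_order all_algebra.
From mathcomp Require Import generic_quotient.
From mathcomp Require Import all_classical all_reals.
From mathcomp Require Import topology num_topology function_spaces.
From mathcomp Require Import normedtype.
Set Implicit Arguments.
Unset Strict Implicit.
Unset Printing Implicit Defensive.
Import Order.TTheory GRing.Theory Num.Theory.
Import numFieldNormedType.Exports.
Local Open Scope classical_set_scope.
Local Open Scope quotient_scope.
Local Open Scope ring_scope.

Definition sigma_compact (T : topologicalType) : Prop :=
  exists2 K : nat -> set T, forall i, compact (K i) & \bigcup_i K i = [set: T].

Definition separable (T : topologicalType) : Prop :=
  exists2 D : set T, countable D & dense D.

Definition path_connected (R : realType) (T : topologicalType) : Prop :=
  forall x y : T, exists f : R -> T,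
    [/\ {within `[0, 1], continuous f}, f 0 = x & f 1 = y].

(* An arbitrary topology on [S], kept apart from any instance [S] may carry;  *)
(* [with_topology tau] is [S] as a [topologicalType] with open sets [tau].    *)
Record topology_on (S : Type) := TopologyOn {
  opens : set_system S ;
  opensT : opens setT ;
  opensI : setI_closed opens ;
  opens_bigU : forall (I : Type) (f : I -> set S),
    (forall i, opens (f i)) -> opens (\bigcup_i f i) }.

Definition with_topology (S : choiceType) (tau : topology_on S) : Type := S.

HB.instance Definition _ (S : choiceType) (tau : topology_on S) :=
  Choice.on (with_topology tau).
HB.instance Definition _ (S : choiceType) (tau : topology_on S) :=
  isOpenTopological.Build (with_topology tau)
    (opensT tau) (@opensI _ tau) (@opens_bigU _ tau).

Lemma open_with_topology (S : choiceType) (tau : topology_on S) :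
  @open (with_topology tau) = opens tau.
Proof. by []. Qed.

Section Channels.
Context {R : realType}.
Implicit Types X Y Z T : finType.

(* [W (x, y)] is the transition probability W(y|x). *)
Definition is_channel X Y (W : X * Y -> R) : Prop :=
  (forall x y, 0 <= W (x, y) <= 1) /\ (forall x, \sum_y W (x, y) = 1).

(* The topology is the one [set_type] inherits from the finite product        *)
(* [{ptws X * Y -> R}], i.e. the Euclidean one.                               *)
Definition channel X Y : Type :=
  set_type [set W : {ptws X * Y -> R} | is_channel W].
HB.instance Definition _ X Y := Topological.on (channel X Y).

Definition chval X Y (W : channel X Y) : X * Y -> R := \val W.

Lemma channelP X Y (W : channel X Y) : is_channel (chval W).
Proof. exact: set_valP W. Qed.

Definition mk_channel X Y (f : X * Y -> R) (fP : is_channel f) : channel X Y :=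
  exist _ (f : {ptws X * Y -> R}) (mem_set fP).

Lemma channel_inj X Y (W W' : channel X Y) :
  (forall x y, chval W (x, y) = chval W' (x, y)) -> W = W'.
Proof. by move=> e; apply: val_inj; apply/funext => -[x y]; exact: e. Qed.

Definition comp_fun X Y Z (V : channel Y Z) (W : channel X Y) (p : X * Z) : R :=
  \sum_y chval V (y, p.2) * chval W (p.1, y).

Lemma is_channel_of X Y (f : X * Y -> R) : (forall x y, 0 <= f (x, y)) ->
  (forall x, \sum_y f (x, y) = 1) -> is_channel f.
Proof.
move=> f0 f1; split=> // x y; rewrite f0 -(f1 x) (bigD1 y)//= lerDl.
exact: sumr_ge0.
Qed.

Lemma comp_funP X Y Z (V : channel Y Z) (W : channel X Y) :
  is_channel (comp_fun V W).
Proof.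
have [V0 V1] := channelP V; have [W0 W1] := channelP W.
apply: is_channel_of => [x z|x]; rewrite /comp_fun /=.
  apply: sumr_ge0 => y _.
  by apply: mulr_ge0; [case/andP: (V0 y z)|case/andP: (W0 x y)].
rewrite exchange_big/= -[RHS](W1 x); apply: eq_bigr => y _.
by rewrite -mulr_suml V1 mul1r.
Qed.

Definition comp_channel X Y Z (V : channel Y Z) (W : channel X Y) :
  channel X Z := mk_channel (comp_funP V W).

Definition degraded X Y Z (W' : channel X Z) (W : channel X Y) : Prop :=
  exists V : channel Y Z, W' = comp_channel V W.

Definition ch_equiv X Y Z (W : channel X Y) (W' : channel X Z) : Prop :=
  degraded W' W /\ degraded W W'.

Lemma id_funP Y : is_channel (fun p : Y * Y => (p.1 == p.2)%:R).
Proof.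
apply: is_channel_of => [x y|x]; first exact: ler0n.
rewrite (bigD1 x)//= eqxx big1 ?addr0// => y.
by rewrite eq_sym => /negbTE ->.
Qed.

Lemma degraded_refl X Y (W : channel X Y) : degraded W W.
Proof.
exists (mk_channel (id_funP Y)); apply: channel_inj => x y.
rewrite /chval /= /comp_fun /= (bigD1 y)//= /chval/= eqxx mul1r.
by rewrite big1 ?addr0// => z /negbTE /= ->; rewrite mul0r.
Qed.

Lemma degraded_trans X Y Z T (W1 : channel X Y) (W2 : channel X Z)
  (W3 : channel X T) : degraded W2 W1 -> degraded W3 W2 -> degraded W3 W1.
Proof.
move=> [V1 ->] [V2 ->]; exists (comp_channel V2 V1); apply: channel_inj => x t.
rewrite /chval /= /comp_fun /=.
under eq_bigr do rewrite {2}/chval/= /comp_fun/= mulr_sumr.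
rewrite exchange_big/=; apply: eq_bigr => y _.
rewrite {3}/chval/= /comp_fun/= mulr_suml.
by apply: eq_bigr => z _; rewrite mulrA.
Qed.

Lemma ch_equiv_refl X Y (W : channel X Y) : ch_equiv W W.
Proof. by split; exact: degraded_refl. Qed.

Lemma ch_equiv_sym X Y Z (W : channel X Y) (W' : channel X Z) :
  ch_equiv W W' -> ch_equiv W' W.
Proof. by case. Qed.

Lemma ch_equiv_trans X Y Z T (W1 : channel X Y) (W2 : channel X Z)
  (W3 : channel X T) : ch_equiv W1 W2 -> ch_equiv W2 W3 -> ch_equiv W1 W3.
Proof. by move=> [? ?] [? ?]; split; apply: degraded_trans; eassumption. Qed.

Definition ch_eqb X Y : rel (channel X Y) := fun W W' => `[< ch_equiv W W' >].

Lemma ch_eqb_refl X Y : reflexive (@ch_eqb X Y).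
Proof. by move=> W; apply/asboolP; exact: ch_equiv_refl. Qed.
Lemma ch_eqb_sym X Y : symmetric (@ch_eqb X Y).
Proof. by move=> W W'; apply: asbool_equiv_eq; split; exact: ch_equiv_sym. Qed.
Lemma ch_eqb_trans X Y : transitive (@ch_eqb X Y).
Proof.
move=> W2 W1 W3 /asboolP h1 /asboolP h2; apply/asboolP.
exact: ch_equiv_trans h1 h2.
Qed.
Canonical ch_eqb_equiv X Y :=
  EquivRel (@ch_eqb X Y) (@ch_eqb_refl X Y) (@ch_eqb_sym X Y) (@ch_eqb_trans X Y).

Definition DMCo X Y : Type := quotient_topology {eq_quot @ch_eqb X Y}.
HB.instance Definition _ X Y := Quotient.on (DMCo X Y).
HB.instance Definition _ X Y := Topological.on (DMCo X Y).

(* The alphabet [n] with n >= 1 is rendered as ['I_m.+1] with m = n - 1.      *)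
Definition DMCstar X : Type := {m : nat & channel X 'I_m.+1}.
HB.instance Definition _ X := Choice.on (DMCstar X).

Definition in_star X (m : nat) (W : channel X 'I_m.+1) : DMCstar X :=
  existT (fun m => channel X 'I_m.+1) m W.

Definition star_eqb X : rel (DMCstar X) :=
  fun c c' => `[< ch_equiv (projT2 c) (projT2 c') >].

Lemma star_eqb_refl X : reflexive (@star_eqb X).
Proof. by move=> W; apply/asboolP; exact: ch_equiv_refl. Qed.
Lemma star_eqb_sym X : symmetric (@star_eqb X).
Proof. by move=> W W'; apply: asbool_equiv_eq; split; exact: ch_equiv_sym. Qed.
Lemma star_eqb_trans X : transitive (@star_eqb X).
Proof.
move=> W2 W1 W3 /asboolP h1 /asboolP h2; apply/asboolP.
exact: ch_equiv_trans h1 h2.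
Qed.
Canonical star_eqb_equiv X :=
  EquivRel (@star_eqb X) (@star_eqb_refl X) (@star_eqb_sym X) (@star_eqb_trans X).

(* Only the quotient set: no topology is attached to it.                      *)
Definition DMCostar X : Type := {eq_quot @star_eqb X}.
HB.instance Definition _ X := Quotient.on (DMCostar X).
HB.instance Definition _ X := Choice.on (DMCostar X).

Definition star_part X (m : nat) : set (DMCostar X) :=
  [set c | exists W : channel X 'I_m.+1, c = \pi_(DMCostar X) (in_star W)].
Arguments star_part : clear implicits.

(* The identification of DMCo X 'I_m.+1 with [star_part X m]; it sends the    *)
(* class of W to the class of W, see [star_emb_pi], [star_emb_inj] and        *)
(* [range_star_emb].                                                          *)
Definition star_emb X (m : nat) (q : DMCo X 'I_m.+1) : DMCostar X :=
  \pi_(DMCostar X) (in_star (repr q)).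
Arguments star_emb {X m} q.

Lemma star_piP X m n (W : channel X 'I_m.+1) (W' : channel X 'I_n.+1) :
  \pi_(DMCostar X) (in_star W) = \pi_(DMCostar X) (in_star W') <-> ch_equiv W W'.
Proof.
have e := @eqmodP _ (star_eqb_equiv X) (in_star W) (in_star W').
by split => [/e/asboolP//|/asboolP/e].
Qed.

Lemma DMCo_piP X Y (W W' : channel X Y) :
  \pi_(DMCo X Y) W = \pi_(DMCo X Y) W' <-> ch_equiv W W'.
Proof.
have e := @eqmodP _ (ch_eqb_equiv X Y) W W'.
by split => [/e/asboolP//|/asboolP/e].
Qed.

Lemma star_emb_pi X m (W : channel X 'I_m.+1) :
  star_emb (\pi_(DMCo X 'I_m.+1) W) = \pi_(DMCostar X) (in_star W).
Proof. by apply/star_piP/DMCo_piP; rewrite reprK. Qed.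

Lemma star_emb_inj X m : injective (@star_emb X m).
Proof. by move=> p q /star_piP/DMCo_piP; rewrite !reprK. Qed.

Lemma range_star_emb X m : range (@star_emb X m) = star_part X m.
Proof.
apply/seteqP; split=> [_ [q _ <-]|_ [W ->]]; first by exists (repr q).
by exists (\pi_(DMCo X 'I_m.+1) W) => //; exact: star_emb_pi.
Qed.

Definition natural X (tau : topology_on (DMCostar X)) : Prop :=
  forall (m : nat) (A : set (DMCo X 'I_m.+1)),
    open A <-> exists2 U : set (with_topology tau),
      open U & star_emb @` A = U `&` star_part X m.

End Channels.
Arguments star_part {R} X m.
Arguments star_emb {R X m} q.
Arguments natural {R X} tau.
Arguments channel R X Y : clear implicits.
Arguments DMCo R X Y : clear implicits.
Arguments DMCstar R X : clear implicits.
Arguments DMCostar R X : clear implicits.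

(* Main.v *)
Require Import Defs.
From mathcomp Require Import all_boot all_order all_algebra.
From mathcomp Require Import all_classical all_reals.
From mathcomp Require Import topology num_topology function_spaces normedtype.
From mathcomp Require Import generic_quotient interval_inference.

(* Naturality makes each map W |-> [W] from DMC_{X,[n]} to (DMC^(o)_{X,*}, T) *)
(* continuous, and these maps jointly cover the target.  DMC_{X,[n]} is a     *)
(* compact convex polytope in which the rational channels are dense, so its   *)
(* images give sigma-compactness and separability.  For path-connectedness,   *)
(* two classes are first represented over a common output alphabet, by        *)
(* relabelling outputs injectively, and then joined by the image of a segment.*)

Set Implicit Arguments.
Unset Strict Implicit.
Unset Printing Implicit Defensive.
Import Order.TTheory GRing.Theory Num.Theory.
Import numFieldNormedType.Exports.
Local Open Scope classical_set_scope.
Local Open Scope quotient_scope.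
Local Open Scope ring_scope.

(** Compactness, countable dense subsets and paths all push forward along continuous maps.
    Naturality is used in [continuous_star_class], which makes every class map [star_class]
    continuous, and by [star_class_surj] these countably many maps cover the space. It remains to
    study channels with a fixed finite output alphabet: [compact_channel] gives sigma-compactness,
    [countable_rational_channel] and [dense_rational_channel] give separability, and
    [channel_path_connected] gives paths once [star_class_widen] has put both endpoints over one
    alphabet. *)

(** * Convergence and compactness in finite products and subspaces *)

Lemma initial_cvgP (S : choiceType) (T : topologicalType) (f : S -> T)
    (F : set_system S) (s : S) : Filter F ->
  F --> (s : initial_topology f) <-> f @ F --> f s.
Proof.
move=> FF; split=> [Fs|Fs].
  by move=> A /(@initial_continuous _ _ f s)/Fs.
move=> A [_ [[B oB <-] Bs] BA]; apply: filterS BA _.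
exact/Fs/open_nbhs_nbhs.
Qed.

Lemma ptws_cvgP (I : finType) (T : topologicalType)
    (F : set_system {ptws I -> T}) (f : {ptws I -> T}) : Filter F ->
  F --> f <-> forall i, g i @[g --> F] --> f i.
Proof.
move=> FF; split=> [Ff i|Ff]; first by move=> A /(@proj_continuous _ _ i f)/Ff.
by apply/cvg_sup => i; apply/initial_cvgP; exact: Ff.
Qed.

Lemma cvg_sumr (R : realType) (T I : Type) (F : set_system T) (r : seq I)
    (P : pred I) (f : I -> T -> R) (a : I -> R) : Filter F ->
  (forall i, P i -> f i x @[x --> F] --> a i) ->
  \sum_(i <- r | P i) f i x @[x --> F] --> \sum_(i <- r | P i) a i.
Proof. by move=> FF; apply: cvg_big; exact: add_continuous. Qed.

(** A cluster point in [A] of the image filter lifts to the subtype, because the open sets there are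
    traces of open sets of [T]. *)
Lemma compact_set_type (T : topologicalType) (A : set T) :
  compact A -> compact [set: set_type A].
Proof.
move=> Aco F FF _.
have /Aco [] : (\val @ F) A.
  by apply: (@filterS _ F _ setT) filterT => x _; exact: set_valP.
move=> x [Ax clx]; exists (exist _ x (mem_set Ax)); split=> // B C FB.
move=> [_ [[O oO <-] Ox] OC].
have [_ [[y By <-] Oy]] : (\val @` B) `&` O !=set0.
  apply: clx; last exact: (open_nbhs_nbhs (conj oO Ox)).
  by apply: (@filterS _ F _ B) FB => y By; exists y.
by exists y; split=> //; exact: OC.
Qed.

Section Channels.
Context {R : realType}.
Implicit Types X Y Z : finType.

(** * Compactness of the space of channels *)

Lemma chvalE X Y (f : X * Y -> R) (fP : is_channel f) p :
  chval (mk_channel fP) p = f p.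
Proof. by []. Qed.

Lemma channel_cvgP X Y (F : set_system (channel R X Y)) (W : channel R X Y) :
  Filter F -> F --> W <-> forall p, chval V p @[V --> F] --> chval W p.
Proof. by move=> FF; rewrite initial_cvgP ptws_cvgP. Qed.

(** Closed conditions, one per entry and one per row sum, cut the channels out of a cube that is
    compact by Tychonoff's theorem. *)
Lemma compact_channel X Y : compact [set: channel R X Y].
Proof.
apply: compact_set_type.
apply: (@subclosed_compact _ _
    [set W : {ptws X * Y -> R} | forall p, `[0, 1]%classic (W p)]).
- rewrite (_ : [set _ | _] =
      (\bigcap_p [set W : {ptws X * Y -> R} | W p \in `[0, 1]])
    `&` \bigcap_x [set W : {ptws X * Y -> R} | \sum_y W (x, y) = 1]).
    apply: closedI.
    + apply: closed_bigI => p _.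
      apply: (@preimage_closed _ _ (fun W : {ptws X * Y -> R} => W p)
        `[0, 1]%classic).
        by move=> W _; exact: proj_continuous.
      exact: itv_closed.
    + apply: closed_bigI => x _.
      apply: (@preimage_closed _ _
        (fun W : {ptws X * Y -> R} => \sum_y W (x, y)) [set 1]).
        move=> W _.
        apply: (@cvg_sumr R _ _ (nbhs W) _ _ (fun y V => V (x, y))) => y _.
        exact: (@proj_continuous _ _ (x, y) W).
      exact: closed_eq.
  apply/seteqP; split=> W.
    by move=> [W0 W1]; split=> [[x y] _|x _] //=; rewrite in_itv/=.
  move=> [W0 W1]; split=> [x y|x]; last exact: W1.
  by have := W0 (x, y) I; rewrite /= in_itv.
- apply: (@tychonoff _ (fun=> R) (fun=> `[0, 1]%classic)) => _.
  exact: segment_compact.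
- by move=> W [W0 _] [x y]; rewrite /= in_itv/=.
Qed.

(** * Rational approximation of channels *)

Lemma floor_divn_cvg (a : R) :
  (Num.floor (n.+1%:R * a))%:~R / n.+1%:R @[n --> \oo] --> a.
Proof.
apply/cvgrPdist_lt => _/posnumP[e]; near=> n.
have n0 : 0 < n.+1%:R :> R by rewrite ltr0n.
have /andP[le1 gt1] := floor_itv (n.+1%:R * a).
rewrite ger0_norm; last by rewrite subr_ge0 ler_pdivrMr// [a * _]mulrC.
apply: (@lt_trans _ _ n.+1%:R^-1);
  last by near: n; exact: near_infty_natSinv_lt.
rewrite ltrBlDr -[X in X + _]mul1r -mulrDl ltr_pdivlMr// mulrC addrC.
by rewrite -[1]/(1%:~R) -rmorphD.
Unshelve. all: by end_near. Qed.

Definition rational_channel X Y : set (channel R X Y) :=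
  [set W | exists q : {ffun X * Y -> rat}, forall p, chval W p = ratr (q p)].

Lemma countable_rational_channel X Y : countable (@rational_channel X Y).
Proof.
(* Choosing a rational table for each channel, with the zero table as default, gives a map that is
   injective on rational channels. *)
have qP (W : channel R X Y) : {q : {ffun X * Y -> rat} |
    rational_channel W -> forall p, chval W p = ratr (q p)}.
  apply: cid; have [[q Wq]|nW] := pselect (rational_channel W).
    by exists q.
  by exists [ffun=> 0] => /nW.
apply/countable_injP; exists (fun W => pickle (sval (qP W))) => V W.
move=> /set_mem ratV /set_mem ratW /(pcan_inj pickleK) e.
apply: channel_inj => x y.
by rewrite (svalP (qP V))// (svalP (qP W))// e.
Qed.

(* The output [b] absorbs the mass lost by rounding the others down, so the   *)
(* rows still sum to 1 and the entry at [b] stays nonnegative and rational.   *)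
Definition round_fun X Y (b : Y) (W : channel R X Y) (n : nat)
    (p : X * Y) : R :=
  let r y := (Num.floor (n.+1%:R * chval W (p.1, y)))%:~R / n.+1%:R in
  if p.2 == b then 1 - \sum_(y | y != b) r y else r p.2.

Lemma round_funP X Y (b : Y) (W : channel R X Y) n :
  is_channel (round_fun b W n).
Proof.
have [W0 W1] := channelP W.
apply: is_channel_of => [x y|x]; rewrite /round_fun/=; last first.
  rewrite (bigD1 b)//= eqxx; under [X in _ + X]eq_bigr do rewrite ifN//.
  by rewrite subrK.
have [_|_] := eqVneq y b; last first.
  rewrite divr_ge0 ?ler0n// ler0z floor_ge0 mulr_ge0 ?ler0n//.
  by case/andP: (W0 x y).
(* The entries rounded down sum to at most the mass of row [x] off [b], hence to at most 1. *)
rewrite subr_ge0 -[leRHS](W1 x) [leRHS](bigD1 b)//= ler_wpDl//.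
  by case/andP: (W0 x b).
by apply: ler_sum => z _; rewrite ler_pdivrMr ?ltr0n// mulrC floor_le.
Qed.

Lemma round_fun_cvg X Y (b : Y) (W : channel R X Y) p :
  round_fun b W n p @[n --> \oo] --> chval W p.
Proof.
case: p => x y; rewrite /round_fun/=.
have [->|_] := eqVneq y b; last exact: floor_divn_cvg.
have -> : chval W (x, b) = 1 - \sum_(y | y != b) chval W (x, y).
  by have [_ W1] := channelP W; rewrite -(W1 x) (bigD1 b)//= addrK.
apply: cvgB; first exact: cvg_cst.
by apply: cvg_sumr => z _; exact: floor_divn_cvg.
Qed.

Lemma rational_round X Y (b : Y) (W : channel R X Y) n :
  rational_channel (mk_channel (round_funP b W n)).
Proof.
pose r x y : rat := (Num.floor (n.+1%:R * chval W (x, y)))%:~R / n.+1%:R.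
exists [ffun p =>
  if p.2 == b then 1 - \sum_(y | y != b) r p.1 y else r p.1 p.2].
have rE x y : ratr (r x y) =
    (Num.floor (n.+1%:R * chval W (x, y)))%:~R / n.+1%:R :> R.
  by rewrite fmorph_div/= ratr_int ratr_nat.
move=> [x y]; rewrite ffunE chvalE /round_fun/=; case: ifP => _.
  rewrite rmorphB rmorph1 rmorph_sum; congr (_ - _).
  by apply: eq_bigr => z _; rewrite [RHS]rE.
by rewrite [RHS]rE.
Qed.

(** The rounded channels are rational and converge entrywise to [W], so they enter every open set
    around it; an output [b] to absorb the rounding exists since [Y] is nonempty. *)
Lemma dense_rational_channel X Y : (0 < #|Y|)%N ->
  dense (@rational_channel X Y).
Proof.
move=> /card_gt0P[b _] O [W OW] oO.
have WO : mk_channel (round_funP b W n) @[n --> \oo] --> W.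
  by apply/channel_cvgP => p; exact: round_fun_cvg.
have [n _ /(_ n (leqnn n)) On] := WO _ (open_nbhs_nbhs (conj oO OW)).
by exists (mk_channel (round_funP b W n)); split=> //; exact: rational_round.
Qed.

(** * Deterministic channels and relabelling of outputs *)

Definition det_fun Y Z (f : Y -> Z) (p : Y * Z) : R := (f p.1 == p.2)%:R.

Lemma det_funP Y Z (f : Y -> Z) : is_channel (det_fun f).
Proof.
apply: is_channel_of => [y z|y]; first exact: ler0n.
rewrite /det_fun/= (bigD1 (f y))//= eqxx big1 ?addr0// => z.
by rewrite eq_sym => /negbTE ->.
Qed.

Definition relabel X Y Z (f : Y -> Z) (W : channel R X Y) : channel R X Z :=
  comp_channel (mk_channel (det_funP f)) W.

Lemma relabelE X Y Z (f : Y -> Z) (W : channel R X Y) x z :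
  chval (relabel f W) (x, z) = \sum_(y | f y == z) chval W (x, y).
Proof.
rewrite chvalE /comp_fun [RHS]big_mkcond; apply: eq_bigr => y _.
by rewrite chvalE /det_fun/=; case: eqP; rewrite ?mul1r ?mul0r.
Qed.

Lemma relabel_equiv X Y Z (f : Y -> Z) (g : Z -> Y) (W : channel R X Y) :
  cancel f g -> ch_equiv W (relabel f W).
Proof.
move=> fK; split; first by exists (mk_channel (det_funP f)).
exists (mk_channel (det_funP g)); rewrite -/(relabel _ _).
apply: channel_inj => x y; rewrite relabelE.
under eq_bigr do rewrite relabelE.
(* If [g z = y] and [f y' = z], then [y' = g (f y') = y], so only the pair [(f y, y)]
   contributes. *)
rewrite pair_big_dep/= (big_pred1 (f y, y))// => -[z y'] /=.
rewrite xpair_eqE; apply/andP/andP => -[/eqP e /eqP e'].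
  by rewrite -e -e' fK !eqxx.
by rewrite e e' fK !eqxx.
Qed.

(** * Segments between channels *)

(** A path is a function on all of [R], so its values must be channels outside the unit interval
    too; clamping keeps the mixing weights valid there. *)
Definition clamp (t : R) : R := Num.max 0 (Num.min t 1).

Lemma clamp_itv t : 0 <= clamp t <= 1.
Proof. by rewrite /clamp le_max lexx/= ge_max ler01/= ge_min lexx orbT. Qed.

Lemma continuous_clamp : continuous clamp.
Proof.
rewrite (_ : clamp = cst 0 \max (id \min cst 1)) //.
apply: max_fun_continuous; first exact: cst_continuous.
by apply: min_fun_continuous; [move=> t; exact: cvg_id|exact: cst_continuous].
Qed.

Definition mix_fun X Y (V W : channel R X Y) (t : R) (p : X * Y) : R :=
  (1 - clamp t) * chval V p + clamp t * chval W p.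

Lemma mix_funP X Y (V W : channel R X Y) t : is_channel (mix_fun V W t).
Proof.
have [V0 V1] := channelP V; have [W0 W1] := channelP W.
have /andP[t0 t1] := clamp_itv t.
apply: is_channel_of => [x y|x]; rewrite /mix_fun.
  case/andP: (V0 x y) => ? _; case/andP: (W0 x y) => ? _.
  by rewrite addr_ge0 ?mulr_ge0 ?subr_ge0.
by rewrite big_split/= -!mulr_sumr V1 W1 !mulr1 subrK.
Qed.

Lemma continuous_mix X Y (V W : channel R X Y) :
  continuous (fun t => mk_channel (mix_funP V W t)).
Proof.
move=> t; apply/channel_cvgP => p.
change (mix_fun V W s p @[s --> t] --> mix_fun V W t p).
have ct := @continuous_clamp t.
apply: cvgD; apply: cvgM => //; try exact: cvg_cst.
by apply: cvgB => //; exact: cvg_cst.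
Qed.

Lemma channel_path_connected X Y : path_connected R (channel R X Y).
Proof.
move=> V W; exists (fun t => mk_channel (mix_funP V W t)); split.
- exact/continuous_subspaceT/continuous_mix.
- apply: channel_inj => x y; rewrite chvalE /mix_fun /clamp.
  by rewrite min_l ?ler01// maxxx subr0 mul1r mul0r addr0.
- apply: channel_inj => x y; rewrite chvalE /mix_fun /clamp.
  by rewrite minxx max_r ?ler01// subrr mul1r mul0r add0r.
Qed.

(** * Transfer to a natural topology *)

Section Natural.
Context {X : finType} {tau : topology_on (DMCostar R X)} (tauN : natural tau).

Definition star_class m (W : channel R X 'I_m.+1) : with_topology tau :=
  \pi_(DMCostar R X) (in_star W).

Lemma star_class_surj (c : with_topology tau) :
  exists m (W : channel R X 'I_m.+1), c = star_class W.
Proof.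
exists (projT1 (repr (c : DMCostar R X))), (projT2 (repr (c : DMCostar R X))).
rewrite /star_class -[LHS](@reprK _ (DMCostar R X)).
by congr (\pi_(_) _); case: (repr _).
Qed.

Lemma continuous_star_class m : continuous (@star_class m).
Proof.
rewrite (_ : @star_class m = star_emb \o \pi_(DMCo R X 'I_m.+1)); last first.
  by apply/funext => W; rewrite /= star_emb_pi.
apply/(@quotient_continuous _ {eq_quot @ch_eqb R X 'I_m.+1}
  (with_topology tau) star_emb).
(* [star_emb] maps the preimage of [U] onto the trace of [U] on [star_part X m], so naturality makes
   that preimage open. *)
apply/continuousP => U oU; apply/(tauN _).2; exists U => //.
apply/seteqP; split=> [_ [q Uq <-]|c [Uc]].
  by split=> //; rewrite -range_star_emb; exists q.
by rewrite -range_star_emb => -[q _ qc]; exists q; rewrite //= /preimage/= qc.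
Qed.

Lemma star_class_relabel m n (f : 'I_m.+1 -> 'I_n.+1) (g : 'I_n.+1 -> 'I_m.+1)
    (W : channel R X 'I_m.+1) :
  cancel f g -> star_class W = star_class (relabel f W).
Proof. by move=> fK; apply/star_piP; exact: relabel_equiv fK. Qed.

Lemma star_class_widen m n (W : channel R X 'I_m.+1) : (m <= n)%N ->
  exists V : channel R X 'I_n.+1, star_class W = star_class V.
Proof.
move=> mn; exists (relabel (widen_ord (mn : (m < n.+1)%N)) W).
(* [inord] undoes the inclusion on its image; its default value elsewhere does not affect
   [cancel]. *)
apply: (@star_class_relabel _ _ _ inord).
by move=> i; apply: val_inj; rewrite /= inordK.
Qed.

Lemma sigma_compact_natural : sigma_compact (with_topology tau).
Proof.
exists (fun m => range (@star_class m)) => [m|].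
  apply: continuous_compact; last exact: compact_channel.
  exact/continuous_subspaceT/continuous_star_class.
apply/seteqP; split=> // c _; have [m [W ->]] := star_class_surj c.
by exists m => //; exists W.
Qed.

Lemma separable_natural : separable (with_topology tau).
Proof.
exists (\bigcup_m (@star_class m @` @rational_channel X 'I_m.+1)).
  apply: bigcup_countable => // m _.
  exact: sub_countable (card_image_le _ _) (countable_rational_channel _ _).
move=> O [c Oc] oO; have [m [W cW]] := star_class_surj c.
have [|||V [OV ratV]] :=
  @dense_rational_channel X 'I_m.+1 _ (@star_class m @^-1` O).
- by rewrite card_ord.
- by exists W; rewrite /preimage/= -cW.
- by move/continuousP: (@continuous_star_class m); apply.
by exists (star_class V); split=> //; exists m => //; exists V.
Qed.

Lemma path_connected_natural : path_connected R (with_topology tau).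
Proof.
move=> c d; have [m [V ->]] := star_class_surj c.
have [n [W ->]] := star_class_surj d.
(* Both classes are represented over ['I_(m + n).+1], which is large enough for either alphabet. *)
have [V' ->] := star_class_widen V (leq_addr n m).
have [W' ->] := star_class_widen W (leq_addl m n).
have [f [fc f0 f1]] := channel_path_connected V' W'.
exists (@star_class _ \o f); split; rewrite /= ?f0 ?f1//.
by move=> t U /(@continuous_star_class _ (f t))/(fc t).
Qed.

End Natural.
End Channels.

Theorem proposition5 (R : realType) (X : finType) (hX : (0 < #|X|)%N)
    (tau : topology_on (DMCostar R X)) (htau : natural tau) :
  [/\ sigma_compact (with_topology tau),
      separable (with_topology tau) &
      path_connected R (with_topology tau)].
Proof.
by split; [exact: sigma_compact_natural|exact: separable_natural|
  exact: path_connected_natural].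
Qed.
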